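(* For $x=(x_{12},x_{13},x_{14},x_{23},x_{42},x_{43})\in\mathbb{C}^6$ let $\operatorname{mon}(x)\in \mathrm{SL}_4(\mathbb{C})$ be the product $$G\,(I+x_{14}E_{14}+x_{23}E_{23})(I+x_{43}E_{43})(I+x_{13}E_{13}+x_{42}E_{42})(I+x_{12}E_{12}),\qquad G=\begin{pmatrix}0&1&0&0\\1&0&0&0\\0&0&0&1\\0&0&1&0\end{pmatrix},$$ where $E_{ij}$ are the elementary $4\times4$ matrices. Let $(p_1,p_2,p_3)\in\mathbb{C}^3$ be given. On the locus of $x$ with $x_{42}\neq0$ such that $\operatorname{mon}(x)$ has characteristic polynomial $T^4-p_3T^3+p_2T^2-p_1T+1$, the variables $x_{12}$ and $x_{23}$ can be eliminated, and there remains exactly one equation, the cubic $$x_{14}x_{42}x_{43}-p_3x_{43}+x_{13}x_{42}+x_{43}^2+p_2+2=0$$ in the variables $x_{13},x_{14},x_{42},x_{43}$; that is, projection to $(x_{13},x_{14},x_{42},x_{43})$ identifies this locus with the part $x_{42}\ne0$ of the hypersurface defined by this cubic equation.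
   Context: The matrix $\operatorname{mon}(x)$ is the topological monodromy (formal monodromy $G$ times Stokes matrices) for rank 4 connections with $z=0$ regular singular and eigenvalues $\pm z^{1/2},\pm tz^{1/2}$ at $z=\infty$, in the case $t=i$. The numbers $p_1,p_2,p_3$ parametrize the parameter space. *)

(* Defs.v *)
From mathcomp Require Import all_boot all_order all_algebra.
From mathcomp Require Import boolp classical_sets functions reals.
From mathcomp Require Import complex mpoly.

Set Implicit Arguments.
Unset Strict Implicit.
Unset Printing Implicit Defensive.

Import GRing.Theory.
Local Open Scope ring_scope.
Local Open Scope complex_scope.

(* A point of C^6 is the row (x12, x13, x14, x23, x42, x43). *)
Definition x12 {K : Type} (x : 'rV[K]_6) : K := x ord0 (@Ordinal 6 0 isT).
Definition x13 {K : Type} (x : 'rV[K]_6) : K := x ord0 (@Ordinal 6 1 isT).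
Definition x14 {K : Type} (x : 'rV[K]_6) : K := x ord0 (@Ordinal 6 2 isT).
Definition x23 {K : Type} (x : 'rV[K]_6) : K := x ord0 (@Ordinal 6 3 isT).
Definition x42 {K : Type} (x : 'rV[K]_6) : K := x ord0 (@Ordinal 6 4 isT).
Definition x43 {K : Type} (x : 'rV[K]_6) : K := x ord0 (@Ordinal 6 5 isT).

(* A point of C^4 is the row (y13, y14, y42, y43). *)
Definition y13 {K : Type} (y : 'rV[K]_4) : K := y ord0 (@Ordinal 4 0 isT).
Definition y14 {K : Type} (y : 'rV[K]_4) : K := y ord0 (@Ordinal 4 1 isT).
Definition y42 {K : Type} (y : 'rV[K]_4) : K := y ord0 (@Ordinal 4 2 isT).
Definition y43 {K : Type} (y : 'rV[K]_4) : K := y ord0 (@Ordinal 4 3 isT).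

Definition proj {K : Type} (x : 'rV[K]_6) : 'rV[K]_4 :=
  \row_(j < 4) tnth [tuple x13 x; x14 x; x42 x; x43 x] j.

(* Row and column labels run from 1 to 4, as in the usual E_{ij}. *)
Definition E {K : fieldType} (i j : nat) : 'M[K]_4 :=
  delta_mx (inord i.-1) (inord j.-1).

Definition G {K : fieldType} : 'M[K]_4 :=
  \matrix_(i < 4, j < 4)
    nth 0 (nth [::] [:: [:: 0; 1; 0; 0];
                        [:: 1; 0; 0; 0];
                        [:: 0; 0; 0; 1];
                        [:: 0; 0; 1; 0]] i) j.

Definition mon {K : fieldType} (x : 'rV[K]_6) : 'M[K]_4 :=
  G *m (1%:M + x14 x *: E 1 4 + x23 x *: E 2 3)
    *m (1%:M + x43 x *: E 4 3)
    *m (1%:M + x13 x *: E 1 3 + x42 x *: E 4 2)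
    *m (1%:M + x12 x *: E 1 2).

Definition has_mon_char_poly {K : fieldType} (p1 p2 p3 : K) (x : 'rV[K]_6) :
    Prop :=
  char_poly (mon x) = 'X^4 - p3 *: 'X^3 + p2 *: 'X^2 - p1 *: 'X + 1.

Definition cubic {K : fieldType} (p2 p3 : K) (y : 'rV[K]_4) : K :=
  y14 y * y42 y * y43 y - p3 * y43 y + y13 y * y42 y + y43 y ^+ 2 + p2 + 2.

Definition mon_locus {K : fieldType} (p1 p2 p3 : K) : set 'rV[K]_6 :=
  [set x | x42 x != 0 /\ has_mon_char_poly p1 p2 p3 x]%classic.

Definition cubic_locus {K : fieldType} (p2 p3 : K) : set 'rV[K]_4 :=
  [set y | y42 y != 0 /\ cubic p2 p3 y = 0]%classic.

(* Regular functions on the principal open subset y42 <> 0 of affine 4-space,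
   i.e. elements of K[y13, y14, y42, y43][1 / y42]; only the values of f on
   this subset matter. *)
Definition regular_away_y42 {K : fieldType} (f : 'rV[K]_4 -> K) : Prop :=
  exists (q : {mpoly K[4]}) (k : nat), forall y : 'rV[K]_4,
    y42 y != 0 -> f y = q.@[fun j => y ord0 j] / y42 y ^+ k.

(* Main.v *)
Require Import Defs.
From mathcomp Require Import all_boot all_order all_algebra.
From mathcomp Require Import boolp classical_sets functions reals.
From mathcomp Require Import complex mpoly ring.

Set Implicit Arguments.
Unset Strict Implicit.
Unset Printing Implicit Defensive.

Import GRing.Theory.
Local Open Scope ring_scope.
Local Open Scope complex_scope.

(* The product of the factors of [mon x] is
     [[0, 1, c, 0], [1, a, b, d], [0, e, f, 1], [0, 0, 1, 0]]
   with c = x23, d = x14, e = x42, f = x43, a = x12 + d e, b = x13 + d f, and its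
   characteristic polynomial is
     T^4 - (a + f) T^3 + (a f - b e - 2) T^2 - (c e + d e - a - f) T + 1.
   The coefficient of T^3 determines x12; given this, the coefficient of T
   determines x23 as soon as e != 0, and the coefficient of T^2 becomes the
   cubic, in which neither x12 nor x23 occurs. *)

(** The coefficients range over any ring so that one format serves both [mon x] over [K] and its
    characteristic matrix over [{poly K}]. *)
Definition mx4 {A : pzRingType} (s : seq (seq A)) : 'M[A]_4 :=
  \matrix_(i < 4, j < 4) nth 0 (nth [::] s i) j.

Lemma mulmx4 (A : pzRingType)
    (a11 a12 a13 a14 a21 a22 a23 a24 a31 a32 a33 a34 a41 a42 a43 a44
     b11 b12 b13 b14 b21 b22 b23 b24 b31 b32 b33 b34 b41 b42 b43 b44 : A) :
  mx4 [:: [:: a11; a12; a13; a14]; [:: a21; a22; a23; a24];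
          [:: a31; a32; a33; a34]; [:: a41; a42; a43; a44]]
  *m mx4 [:: [:: b11; b12; b13; b14]; [:: b21; b22; b23; b24];
             [:: b31; b32; b33; b34]; [:: b41; b42; b43; b44]] =
  let e x y z t x' y' z' t' := x * x' + (y * y' + (z * z' + t * t')) in
  let r x y z t := [:: e x y z t b11 b21 b31 b41; e x y z t b12 b22 b32 b42;
                       e x y z t b13 b23 b33 b43; e x y z t b14 b24 b34 b44] in
  mx4 [:: r a11 a12 a13 a14; r a21 a22 a23 a24;
          r a31 a32 a33 a34; r a41 a42 a43 a44].
Proof.
apply/matrixP=> i j; rewrite !mxE !big_ord_recl big_ord0 !mxE /= addr0.
by case: i => [[|[|[|[|i]]]] //= hi]; case: j => [[|[|[|[|j]]]] //= hj].
Qed.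

Lemma mon_factors (K : fieldType) (x : 'rV[K]_6) :
  mon x =
    mx4 [:: [:: 0; 1; 0; 0]; [:: 1; 0; 0; 0]; [:: 0; 0; 0; 1]; [:: 0; 0; 1; 0]]
    *m mx4 [:: [:: 1; 0; 0; x14 x]; [:: 0; 1; x23 x; 0];
               [:: 0; 0; 1; 0]; [:: 0; 0; 0; 1]]
    *m mx4 [:: [:: 1; 0; 0; 0]; [:: 0; 1; 0; 0];
               [:: 0; 0; 1; 0]; [:: 0; 0; x43 x; 1]]
    *m mx4 [:: [:: 1; 0; x13 x; 0]; [:: 0; 1; 0; 0];
               [:: 0; 0; 1; 0]; [:: 0; x42 x; 0; 1]]
    *m mx4 [:: [:: 1; x12 x; 0; 0]; [:: 0; 1; 0; 0];
               [:: 0; 0; 1; 0]; [:: 0; 0; 0; 1]].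
Proof.
rewrite /mon; congr (_ *m _ *m _ *m _ *m _).
all: apply/matrixP=> i j; rewrite !mxE -!val_eqE /= !inordK //=.
all: case: i => [[|[|[|[|i]]]] //= hi]; case: j => [[|[|[|[|j]]]] //= hj].
all: by rewrite ?(mulr0, mulr1, addr0, add0r).
Qed.

Lemma mon_entries (K : fieldType) (x : 'rV[K]_6) :
  mon x = mx4
    [:: [:: 0; 1; x23 x; 0];
        [:: 1; x12 x + x14 x * x42 x; x13 x + x14 x * x43 x; x14 x];
        [:: 0; x42 x; x43 x; 1];
        [:: 0; 0; 1; 0]].
Proof.
rewrite mon_factors.
(* One round per product, from the left; clearing zeros and ones each time keeps the entries
   small. *)
do 4![rewrite mulmx4 /= ?(mulr0, mulr1, mul0r, mul1r, addr0, add0r)].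
by [].
Qed.

Lemma det_mx4 (A : comPzRingType)
    (a11 a12 a13 a14 a21 a22 a23 a24 a31 a32 a33 a34 a41 a42 a43 a44 : A) :
  \det (mx4 [:: [:: a11; a12; a13; a14]; [:: a21; a22; a23; a24];
                [:: a31; a32; a33; a34]; [:: a41; a42; a43; a44]]) =
  let d3 b1 b2 b3 c1 c2 c3 d1 d2 d3 :=
    b1 * (c2 * d3 - c3 * d2) - b2 * (c1 * d3 - c3 * d1)
    + b3 * (c1 * d2 - c2 * d1) in
  a11 * d3 a22 a23 a24 a32 a33 a34 a42 a43 a44
  - a12 * d3 a21 a23 a24 a31 a33 a34 a41 a43 a44
  + a13 * d3 a21 a22 a24 a31 a32 a34 a41 a42 a44
  - a14 * d3 a21 a22 a23 a31 a32 a33 a41 a42 a43.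
Proof.
(* Three expansions along the first row lead down to 1x1 minors. *)
do 3![rewrite !(expand_det_row _ ord0) !big_ord_recl !big_ord0 /cofactor].
rewrite !det_mx11 !mxE /= !(expr0, expr1, expr2, exprS); ring.
Qed.

Lemma char_poly_mon (K : fieldType) (x : 'rV[K]_6) :
  char_poly (mon x) =
    'X^4 - (x12 x + x14 x * x42 x + x43 x) *: 'X^3
    + ((x12 x + x14 x * x42 x) * x43 x - (x13 x + x14 x * x43 x) * x42 x - 2)
        *: 'X^2
    - (x23 x * x42 x - x12 x - x43 x) *: 'X + 1.
Proof.
rewrite /char_poly; have -> : char_poly_mx (mon x) = mx4
    [:: [:: 'X; -1; - (x23 x)%:P; 0];
        [:: -1; 'X - (x12 x + x14 x * x42 x)%:P;
            - (x13 x + x14 x * x43 x)%:P; - (x14 x)%:P];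
        [:: 0; - (x42 x)%:P; 'X - (x43 x)%:P; -1];
        [:: 0; 0; -1; 'X]] :> 'M_4.
  rewrite mon_entries; apply/matrixP=> i j; rewrite !mxE -!val_eqE /=.
  case: i => [[|[|[|[|i]]]] //= hi]; case: j => [[|[|[|[|j]]]] //= hj];
  by rewrite ?(mulr1n, mulr0n, sub0r, subr0, oppr0).
rewrite det_mx4 /= -!mul_polyC; ring.
Qed.

Lemma det_mon (K : fieldType) (x : 'rV[K]_6) : \det (mon x) = 1.
Proof. by rewrite mon_entries det_mx4 /=; ring. Qed.

(** Both polynomials are monic of degree 4 with constant term 1, so only the three middle
    coefficients have to be compared. *)
Lemma has_mon_char_polyP (K : fieldType) (p1 p2 p3 : K) (x : 'rV[K]_6) :
  has_mon_char_poly p1 p2 p3 x <->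
  [/\ x12 x + x14 x * x42 x + x43 x = p3,
      (x12 x + x14 x * x42 x) * x43 x
        - (x13 x + x14 x * x43 x) * x42 x - 2 = p2 &
      x23 x * x42 x - x12 x - x43 x = p1].
Proof.
rewrite /has_mon_char_poly char_poly_mon; split=> [eq_p | [-> -> ->] //].
have eq_coef k := congr1 (coefp k) eq_p.
move: (eq_coef 3%N) (eq_coef 2%N) (eq_coef 1%N).
rewrite /= !coefE /= !(mulr0, mulr1, mul0r, addr0, add0r, subr0, oppr0, sub0r).
by move=> /oppr_inj-> -> /oppr_inj->.
Qed.

Lemma projE (K : Type) (x : 'rV[K]_6) :
  [/\ y13 (proj x) = x13 x, y14 (proj x) = x14 x,
      y42 (proj x) = x42 x & y43 (proj x) = x43 x].
Proof. by rewrite /y13 /y14 /y42 /y43 /proj !mxE. Qed.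

Definition elim_x12 {K : fieldType} (p3 : K) (y : 'rV[K]_4) : K :=
  p3 - y43 y - y14 y * y42 y.

(** Adding the equations for the coefficients of T^3 and T cancels x12 and x43, leaving x23 x42 +
    x14 x42 = p1 + p3. *)
Definition elim_x23 {K : fieldType} (p1 p3 : K) (y : 'rV[K]_4) : K :=
  (p1 + p3 - y14 y * y42 y) / y42 y.

Lemma regular_elim_x12 (K : fieldType) (p3 : K) :
  regular_away_y42 (elim_x12 p3).
Proof.
exists (p3%:MP - 'X_(@Ordinal 4 3 isT)
        - 'X_(@Ordinal 4 1 isT) * 'X_(@Ordinal 4 2 isT))%MP, 0%N => y _.
by rewrite expr0 divr1 !(mevalB, mevalM, mevalC, mevalXU).
Qed.

Lemma regular_elim_x23 (K : fieldType) (p1 p3 : K) :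
  regular_away_y42 (elim_x23 p1 p3).
Proof.
exists ((p1 + p3)%:MP - 'X_(@Ordinal 4 1 isT) * 'X_(@Ordinal 4 2 isT))%MP, 1%N.
by move=> y _; rewrite expr1 !(mevalB, mevalM, mevalC, mevalXU).
Qed.

Lemma has_mon_char_poly_elim (K : fieldType) (p1 p2 p3 : K) (x : 'rV[K]_6) :
  x42 x != 0 ->
  has_mon_char_poly p1 p2 p3 x <->
  [/\ x12 x = elim_x12 p3 (proj x), x23 x = elim_x23 p1 p3 (proj x) &
      cubic p2 p3 (proj x) = 0].
Proof.
move=> x42_neq0; rewrite has_mon_char_polyP /elim_x12 /elim_x23 /cubic.
have [-> -> -> ->] := projE x; split.
  by case=> <- <- <-; split; [ring | field | ring].
case=> -> -> cubic0; split; [ring | | by field].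
(* After substitution for x12, the T^2 coefficient minus p2 is the negative of the cubic. *)
by apply/eqP; rewrite -subr_eq0 -oppr_eq0 -cubic0; apply/eqP; ring.
Qed.

Lemma proj_mon_locus_bij (K : fieldType) (p1 p2 p3 : K) :
  set_bij (mon_locus p1 p2 p3) (cubic_locus p2 p3) (@proj K).
Proof.
split.
- move=> x [x42_neq0 /has_mon_char_poly_elim[//|_ _ cubic0]].
  by split=> //; have [_ _ -> _] := projE x.
- move=> x x'; rewrite !inE.
  move=> [nz /has_mon_char_poly_elim[//|h12 h23 _]].
  move=> [nz' /has_mon_char_poly_elim[//|h12' h23' _]] eq_proj.
  have [e13 e14 e42 e43] := projE x; have [e13' e14' e42' e43'] := projE x'.
  (* Both points now have their six coordinates expressed through the same point [proj x']. *)
  rewrite eq_proj in h12 h23 e13 e14 e42 e43.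
  (* The coordinate functions use ordinals whose bound is proved by [isT]. *)
  apply/rowP=> -[[|[|[|[|[|[|j]]]]]] //= hj]; rewrite (bool_irrelevance hj isT).
  + exact: etrans h12 (esym h12').
  + exact: etrans (esym e13) e13'.
  + exact: etrans (esym e14) e14'.
  + exact: etrans h23 (esym h23').
  + exact: etrans (esym e42) e42'.
  + exact: etrans (esym e43) e43'.
- move=> y [y42_neq0 cubic0] /=.
  (* The preimage is forced: four coordinates come from [y], the other two from the elimination
     formulas. *)
  pose x : 'rV[K]_6 := \row_j tnth [tuple elim_x12 p3 y; y13 y; y14 y;
    elim_x23 p1 p3 y; y42 y; y43 y] j.
  have proj_x : proj x = y.
    apply/rowP=> -[[|[|[|[|j]]]] //= hj]; rewrite (bool_irrelevance hj isT);
    by rewrite /x !mxE /= /x13 /x14 /x42 /x43 /= !mxE.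
  have x42E : x42 x = y42 y by rewrite /x42 mxE.
  exists x => //; split; first by rewrite x42E.
  apply/has_mon_char_poly_elim; rewrite ?x42E ?proj_x //.
  by split=> //; rewrite /x12 /x23 mxE.
Qed.

Theorem mainTheorem9 (R : realType) (p1 p2 p3 : R[i]) :
  [/\ (forall x : 'rV[R[i]]_6, \det (mon x) = 1),
      (exists f12 f23 : 'rV[R[i]]_4 -> R[i],
         [/\ regular_away_y42 f12, regular_away_y42 f23 &
             forall x : 'rV[R[i]]_6, x42 x != 0 ->
               has_mon_char_poly p1 p2 p3 x <->
               [/\ x12 x = f12 (proj x), x23 x = f23 (proj x) &
                   cubic p2 p3 (proj x) = 0]]) &
      set_bij (mon_locus p1 p2 p3) (cubic_locus p2 p3) (@proj R[i])].
Proof.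
split; [exact: det_mon | | exact: proj_mon_locus_bij].
exists (elim_x12 p3), (elim_x23 p1 p3).
split; [exact: regular_elim_x12 | exact: regular_elim_x23 |].
exact: has_mon_char_poly_elim.
Qed.
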